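(* Let $(M,g)$ be an oriented Riemannian manifold, let $q\in\mathbb{R}$ and let $X$ be a smooth unit vector field on $M$. Then $X$ is a critical point of the Landau-Hall functional (with charge $q$) under compactly supported variations in $\mathfrak{X}_1(M)$ if and only if $X$ is a critical point of the Dirichlet energy under compactly supported variations in $\mathfrak{X}_1(M)$.
   Context: $\mathfrak{X}_1(M)$ denotes the space of smooth unit vector fields on $M$. Let $UM\subset TM$ be the unit tangent sphere bundle with the metric $g_S$ induced from the Sasaki metric of $TM$ (for which horizontal and vertical lifts satisfy $g_S(Y^{\mathsf h},Z^{\mathsf h})=g_S(Y^{\mathsf v},Z^{\mathsf v})=g(Y,Z)$, $g_S(Y^{\mathsf h},Z^{\mathsf v})=0$). Let $\eta$ be the contact 1-form on $UM$ given at $u\in U_pM$ by $\eta_u(W)=g_p(u,\pi_*W)$ for $W\in T_u(UM)$, where $\pi:UM\to M$ is the projection. A compactly supported variation of $X$ in $\mathfrak{X}_1(M)$ is a smooth family $\{X^{(s)}\}_{|s|<\varepsilon}$ of unit vector fields with $X^{(0)}=X$ and $X^{(s)}=X$ outside a compact set contained in the interior of a compact region $\mathsf D\subset M$. Regarding $X^{(s)}$ as a map $(M,g)\to(UM,g_S)$, the Dirichlet energy is $E(X^{(s)};\mathsf D)=\int_{\mathsf D}\frac12|dX^{(s)}|^2\,dv_g$, and the Landau-Hall functional with charge $q$ is $$\mathrm{LH}(X^{(s)};\mathsf D)=E(X^{(s)};\mathsf D)+q\int_{\mathsf D}\eta_{X^{(s)}}\big(X^{(s)}_*X\big)\,dv_g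 ,$$ where $X^{(s)}_*X$ is the image of $X=X^{(0)}$ under the differential of $X^{(s)}$. $X$ is a critical point of one of these functionals if its derivative at $s=0$ vanishes for all such $\mathsf D$ and all such variations. *)

(* Defs.v *)
From HB Require Import structures.
From mathcomp Require Import all_boot all_order all_algebra.
From mathcomp Require Import all_classical all_reals all_analysis.

Set Implicit Arguments.
Unset Strict Implicit.
Unset Printing Implicit Defensive.

Import Order.TTheory GRing.Theory Num.Theory numFieldNormedType.Exports.

Local Open Scope classical_set_scope.
Local Open Scope ring_scope.

Fixpoint iter_derive (R : realType) (V W : normedModType R) (f : V -> W)
    (vs : seq V) : V -> W :=
  if vs is v :: vs' then fun x => 'D_v (iter_derive f vs') x else f.

(* C^oo on an open set [U]: every iterated directional derivative of [f],
   including [f] itself, is Frechet differentiable at every point of [U]. *)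
Definition smooth_on (R : realType) (V W : normedModType R) (U : set V)
    (f : V -> W) : Prop :=
  forall (vs : seq V) (x : V), U x -> differentiable (iter_derive f vs) x.

(* A (nonempty) oriented smooth manifold without boundary of dimension [n], not
   necessarily connected, given by an oriented atlas.  [chart i] and
   [inv_chart i] are total functions, meaningful only on [dom i] and
   [chart i @` dom i] respectively.  [chart_at p] is a preferred chart at [p]:
   it is what allows tangent vectors at [p] to be row vectors (see
   [tangent]); no smoothness in [p] is assumed of it. *)
Record oriented_manifold (R : realType) (n : nat) := OrientedManifold {
  carrier :> ptopologicalType;
  carrier_hausdorff : hausdorff_space carrier;
  carrier_second_countable : @second_countable carrier;
  chart_index : Type;
  dom : chart_index -> set carrier;
  chart : chart_index -> carrier -> 'rV[R]_n;
  inv_chart : chart_index -> 'rV[R]_n -> carrier;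
  chart_at : carrier -> chart_index;
  dom_chart_at : forall p, dom (chart_at p) p;
  open_dom : forall i, open (dom i);
  open_chart_dom : forall i, open (chart i @` dom i);
  chartK : forall i p, dom i p -> inv_chart i (chart i p) = p;
  chart_continuous : forall i p, dom i p -> {for p, continuous (chart i)};
  inv_chart_continuous : forall i y,
    (chart i @` dom i) y -> {for y, continuous (inv_chart i)};
  transition_smooth : forall i j,
    smooth_on (chart i @` (dom i `&` dom j)) (chart j \o inv_chart i);
  transition_oriented : forall i j p, dom i p -> dom j p ->
    0 < \det (jacobian (chart j \o inv_chart i) (chart i p))
}.

Section Manifold.
Variables (R : realType) (n : nat) (M : oriented_manifold R n).
Implicit Types (p : M) (i j : chart_index M).

Definition chart_cod i : set 'rV[R]_n := chart i @` dom i.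

(* A tangent vector at [p] is the row of its components in the chart
   [chart_at p].  The components in another chart [j] around [p] are obtained
   by multiplying on the right by [tjac (chart_at p) j p]. *)
Definition tangent p : Type := 'rV[R]_n.

Definition tjac i j p : 'M[R]_n :=
  jacobian (chart j \o inv_chart i) (chart i p).

(* The total space TM, as a set: a base point and a tangent vector there.  (The
   product topology is not that of TM, and is not used.) *)
Definition tangent_bundle : Type := (M * 'rV[R]_n)%type.

(* The chart of TM induced by [chart i]:
   u = v^k d/dx^k |-> (x^1,...,x^n, v^1,...,v^n). *)
Definition tchart i (u : tangent_bundle) : 'rV[R]_n * 'rV[R]_n :=
  (chart i u.1, u.2 *m tjac (chart_at u.1) i u.1).

Definition inv_tchart i (z : 'rV[R]_n * 'rV[R]_n) : tangent_bundle :=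
  let p := inv_chart i z.1 in (p, z.2 *m tjac i (chart_at p) p).

(* T_u(TM), in components relative to the chart [tchart (chart_at u.1)]. *)
Definition tangent2 (u : tangent_bundle) : Type := ('rV[R]_n * 'rV[R]_n)%type.

(* The differential of the projection pi : TM -> M. *)
Definition dproj (u : tangent_bundle) (W : tangent2 u) : tangent u.1 :=
  let i := chart_at u.1 in
  'd (chart i \o fst \o inv_tchart i) (tchart i u) W.

Definition vector_field : Type := forall p, tangent p.

Definition section (X : vector_field) (p : M) : tangent_bundle := (p, X p).

(* The differential at [p] of a vector field, as a map M -> TM. *)
Definition dsection (X : vector_field) p (Y : tangent p) :
    tangent2 (section X p) :=
  let i := chart_at p in
  'd (tchart i \o section X \o inv_chart i) (chart i p) Y.

(* The component functions of [X] in the chart [i]. *)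
Definition field_rep (X : vector_field) i (y : 'rV[R]_n) : 'rV[R]_n :=
  (tchart i (section X (inv_chart i y))).2.

Definition smooth_field (X : vector_field) : Prop :=
  forall i, smooth_on (chart_cod i) (field_rep X i).

(* The matrix (g_ab) in the chart [i] of a field of bilinear forms whose Gram
   matrix at [p] in the chart [chart_at p] is [gram p]. *)
Definition metric_rep (gram : M -> 'M[R]_n) i (y : 'rV[R]_n) : 'M[R]_n :=
  let p := inv_chart i y in
  let J := tjac i (chart_at p) p in J *m gram p *m J^T.

Record riemannian_metric := RiemannianMetric {
  gram :> M -> 'M[R]_n;
  gram_sym : forall p, (gram p)^T = gram p;
  gram_pos : forall p (v : 'rV[R]_n),
    v != 0 -> 0 < (v *m gram p *m v^T) 0 0;
  gram_smooth : forall i, smooth_on (chart_cod i) (metric_rep gram i)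
}.

Definition borel : Type := g_sigma_algebraType (@open M).
HB.instance Definition _ := Measurable.on borel.

End Manifold.

Section Geometry.
Variables (R : realType) (n : nat) (M : oriented_manifold R n).
Variable g : riemannian_metric M.
Implicit Types p : M.

Definition inner p (v w : tangent p) : R := (v *m g p *m w^T) 0 0.

(* d_c g_ab at [p], in the chart [chart_at p]. *)
Definition dmetric p (c a b : 'I_n) : R :=
  let i := chart_at p in
  'D_(delta_mx 0 c) (fun y => metric_rep g i y a b) (chart i p).

(* Gamma^k_ab at [p] of the Levi-Civita connection, in the chart
   [chart_at p]. *)
Definition christoffel p (k a b : 'I_n) : R :=
  let i := chart_at p in
  2^-1 * \sum_(l < n) invmx (metric_rep g i (chart i p)) k l *
    (dmetric p a b l + dmetric p b a l - dmetric p l a b).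

(* Gamma(Y, u)^k = Gamma^k_ab Y^a u^b. *)
Definition christoffel_form p (Y u : tangent p) : tangent p :=
  \row_k \sum_(a < n) \sum_(b < n)
    christoffel p k a b * (Y : 'rV_n) 0 a * (u : 'rV_n) 0 b.

(* The lifts of tangent vectors at [u.1] to T_u(TM). *)
Definition hlift (u : tangent_bundle M) (Y : tangent u.1) : tangent2 u :=
  (Y, - christoffel_form Y u.2).

Definition vlift (u : tangent_bundle M) (Y : tangent u.1) : tangent2 u :=
  (0, Y).

(* The connection map: [connector W] is the vector whose vertical lift is the
   vertical part of [W] (see [tangent2_decomp]). *)
Definition connector (u : tangent_bundle M) (W : tangent2 u) : tangent u.1 :=
  (W.2 + christoffel_form (dproj W) u.2 : 'rV_n).

(* The Sasaki metric of TM, characterized by [sasaki_hh], [sasaki_vv] and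
   [sasaki_hv]. *)
Definition sasaki (u : tangent_bundle M) (W W' : tangent2 u) : R :=
  inner (dproj W) (dproj W') + inner (connector W) (connector W').

Lemma near_linear_diff (V W : normedModType R) (f : V -> W)
    (l : {linear V -> W}) (x : V) :
  continuous l -> (\forall y \near x, f y = l y) -> 'd f x = l :> (V -> W).
Proof.
move=> lc fl; apply: diff_unique => //; apply/eqaddoP => e e0.
have fx : f x = l x := nbhs_singleton fl.
have : \forall h \near (0 : V), f (h + x) = l (h + x).
  have hc : {for (0 : V), continuous (fun h : V => h + x)}.
    by apply: cvgD; [exact: cvg_id | exact: cvg_cst].
  by move: fl; rewrite -{1}(add0r x) => /hc.
apply: filterS => h /= fh.
rewrite !fctE /= fh fx linearD.
by rewrite (addrC (l h)) subrr normr0 mulr_ge0 // ltW.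
Qed.

Lemma dprojE (u : tangent_bundle M) (W : tangent2 u) : dproj W = W.1.
Proof.
rewrite /dproj; set i := chart_at u.1.
rewrite (@near_linear_diff _ _ _ (fst : {linear _ -> _})) //.
  by move=> z; exact: cvg_fst.
have U : nbhs (chart i u.1) (chart i @` dom i).
  apply: open_nbhs_nbhs; split; first exact: open_chart_dom.
  by exists u.1 => //; exact: dom_chart_at.
have fc : {for tchart i u, continuous (fst : 'rV[R]_n * 'rV[R]_n -> 'rV[R]_n)}.
  exact: cvg_fst.
have h : nbhs (tchart i u) (fst @^-1` (chart i @` dom i)) by exact: fc _ U.
apply: filterS h => z [p pd pz] /=.
by rewrite -pz chartK.
Qed.

Lemma christoffel_form0 p (u : tangent p) :
  christoffel_form (0 : 'rV_n) u = 0 :> 'rV_n.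
Proof.
apply/rowP => k; rewrite !mxE big1 // => a _; rewrite big1 // => b _.
by rewrite mxE mulr0 mul0r.
Qed.

Lemma connector_hlift (u : tangent_bundle M) (Y : tangent u.1) :
  connector (hlift Y) = 0 :> 'rV_n.
Proof. by rewrite /connector dprojE /hlift /= addNr. Qed.

Lemma connector_vlift (u : tangent_bundle M) (Y : tangent u.1) :
  connector (vlift Y) = Y.
Proof. by rewrite /connector dprojE /vlift /= christoffel_form0 addr0. Qed.

Lemma tangent2_decomp (u : tangent_bundle M) (W : tangent2 u) :
  W = (hlift (dproj W) : 'rV_n * 'rV_n) + vlift (connector W)
    :> 'rV_n * 'rV_n.
Proof.
rewrite /hlift /vlift /connector dprojE; case: W => W1 W2 /=.
by congr pair; rewrite /= ?addr0 // addrCA addNr addr0.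
Qed.

Lemma sasaki_hh (u : tangent_bundle M) (Y Z : tangent u.1) :
  sasaki (hlift Y) (hlift Z) = inner Y Z.
Proof.
rewrite /sasaki !connector_hlift !dprojE /=.
by rewrite [X in _ + X]/inner !mul0mx mxE addr0.
Qed.

Lemma sasaki_vv (u : tangent_bundle M) (Y Z : tangent u.1) :
  sasaki (vlift Y) (vlift Z) = inner Y Z.
Proof.
rewrite /sasaki !connector_vlift !dprojE /=.
by rewrite [X in X + _]/inner !mul0mx mxE add0r.
Qed.

Lemma sasaki_hv (u : tangent_bundle M) (Y Z : tangent u.1) :
  sasaki (hlift Y) (vlift Z) = 0.
Proof.
rewrite /sasaki connector_hlift connector_vlift !dprojE /=.
by rewrite /inner trmx0 mulmx0 !mul0mx mxE addr0.
Qed.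

Definition unit_tangent_bundle : set (tangent_bundle M) :=
  [set u | @inner u.1 u.2 u.2 = 1].

(* T_u(UM) is a subspace of T_u(TM): [W] ranges here over the latter. *)
Definition contact_form (u : tangent_bundle M) (W : tangent2 u) : R :=
  @inner u.1 u.2 (dproj W).

Definition unit_vector_field (X : vector_field M) : Prop :=
  smooth_field X /\ forall p, unit_tangent_bundle (section X p).

(* |dX|^2 at [p], with respect to [g] on M and the Sasaki metric on UM:
   g^ab g_S(dX(e_a), dX(e_b)). *)
Definition norm2_dsection (X : vector_field M) p : R :=
  \sum_(a < n) \sum_(b < n) invmx (g p) a b *
    sasaki (@dsection _ _ M X p (delta_mx 0 a))
           (@dsection _ _ M X p (delta_mx 0 b)).

End Geometry.

(* The integral over R^n of a nonnegative Borel function, as an iterated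
   integral with respect to one-dimensional Lebesgue measure. *)
Fixpoint integral_rV (R : realType) (n : nat) :
    ('rV[R]_n -> \bar R) -> \bar R :=
  match n with
  | 0 => fun f => f 0
  | m.+1 => fun f =>
      (\int[lebesgue_measure]_(t in [set: R])
         integral_rV (fun v : 'rV[R]_m => f (row_mx t%:M v)))%E
  end.

(* [mu] is dv_g: in each chart it has density sqrt(det (g_ab)). *)
Definition is_riemannian_volume (R : realType) (n : nat)
    (M : oriented_manifold R n) (g : riemannian_metric M)
    (mu : {measure set (borel M) -> \bar R}) : Prop :=
  forall (i : chart_index M) (A : set (borel M)),
    measurable A -> A `<=` dom i ->
    mu A = integral_rV (fun y =>
      (\1_(chart i @` A) y * Num.sqrt (\det (metric_rep g i y)))%:E).

Section Functionals.
Variables (R : realType) (n : nat) (M : oriented_manifold R n).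
Variable g : riemannian_metric M.
Variable dvg : {measure set (borel M) -> \bar R}.

Definition dirichlet_energy (X : vector_field M) (D : set (borel M)) : R :=
  \int[dvg]_(p in D) (2^-1 * norm2_dsection g X p).

(* [X0] is the field whose image under the differential of [X] is integrated. *)
Definition landau_hall (q : R) (X0 X : vector_field M) (D : set (borel M)) : R :=
  dirichlet_energy X D +
  q * \int[dvg]_(p in D) contact_form g (@dsection _ _ M X p (X0 p)).

Definition compact_region (D : set M) : Prop :=
  compact D /\ D = closure (interior D).

(* [Xs] is a variation of [X] with parameter |s| < eps, supported in the
   interior of [D]; the values of [Xs] at other parameters are irrelevant. *)
Definition variation (X : vector_field M) (D : set M) (eps : R)
    (Xs : R -> vector_field M) : Prop :=
  [/\ 0 < eps,
      forall i, smooth_on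
        [set z : R * 'rV[R]_n | `|z.1| < eps /\ chart_cod i z.2]
        (fun z => field_rep (Xs z.1) i z.2),
      forall s, `|s| < eps -> unit_vector_field g (Xs s),
      forall p, Xs 0 p = X p &
      exists K : set M, [/\ compact K, K `<=` interior D &
        forall s p, `|s| < eps -> ~ K p -> Xs s p = X p]].

Definition critical_point (F : vector_field M -> set M -> R)
    (X : vector_field M) : Prop :=
  forall (D : set M) (eps : R) (Xs : R -> vector_field M),
    compact_region D -> variation X D eps Xs ->
    is_derive (0 : R) (1 : R) (fun s : R => F (Xs s) D) 0.

End Functionals.

(* Main.v *)
Require Import Defs.
From mathcomp Require Import all_boot all_order all_algebra.
From mathcomp Require Import finmap.
From mathcomp Require Import all_classical all_reals all_analysis.
From mathcomp Require Import measurable_realfun.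
From mathcomp Require Import ring lra.

(** The contact form only sees the horizontal part of a tangent vector to the
    unit tangent bundle, and the differential of a section projects back to the
    vector it is applied to ([proj_dsection]).  So the charge term of the
    Landau-Hall functional of a variation X^s of X is q times the integral over
    D of g(X^s, X).  Both fields have length one, hence
    g(X^s, X) = 1 - |X^s - X|^2 / 2 ([inner_polar]): the integrand is maximal
    at s = 0 and, X^s depending smoothly on s, differs from its maximum by
    O(s^2).  The charge term therefore has derivative zero at s = 0 along every
    variation, whether or not X is critical ([is_derive_charge_term]), and it does
    not affect critical points.

    Two points need care.  The O(s^2) must be uniform over D: near each point
    the mean value theorem in a chart bounds the components of X^s - X by a
    multiple of |s| ([near_sq_dist_le]), and compactness of D makes the constant
    uniform ([compact_sq_dist_le]).  The volume of D must be finite, as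
    otherwise the integral could not be estimated by its integrand; this
    follows from compactness and local finiteness of the volume
    ([volume_locally_finite]), which in turn rests on a bound for the iterated
    integral of a bounded function supported in a cube ([integral_rV_box]). *)

Set Implicit Arguments.
Unset Strict Implicit.
Unset Printing Implicit Defensive.

Import Order.TTheory GRing.Theory Num.Theory numFieldNormedType.Exports.

Local Open Scope classical_set_scope.
Local Open Scope ring_scope.

(** * Bilinear forms and determinants *)

Lemma ler_entry_norm (R : realType) m n (A : 'M[R]_(m, n)) i j :
  `|A i j| <= `|A|.
Proof.
rewrite [leRHS]/Num.norm /= mx_normrE.
exact: (le_bigmax _ (fun ij => `|A ij.1 ij.2|) (i, j)).
Qed.

Lemma near_norm_le (R : realType) (T : topologicalType)
    (V : normedModType R) (f : T -> V) x :
  {for x, continuous f} -> \forall y \near x, `|f y| <= `|f x| + 1.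
Proof. by move=> fx; apply: (cvgr_norm_le (f x)) => //; rewrite ltrDl. Qed.

Lemma cvg_det (R : realType) (T : Type) (F : set_system T) {FF : Filter F} n
    (f : T -> 'M[R]_n) (A : 'M[R]_n) :
  f @ F --> A -> \det (f x) @[x --> F] --> \det A.
Proof.
move=> fA; rewrite /determinant; apply: cvg_big => // [|s _].
  exact: add_continuous.
apply: cvgM; first exact: cvg_cst.
apply: cvg_big => // [|i _]; first exact: mul_continuous.
exact: cvg_comp fA (@coord_continuous _ _ _ _ _ A).
Qed.

Lemma form_sumE (R : realType) n (u w : 'rV[R]_n) (A : 'M[R]_n) :
  (u *m A *m w^T) 0 0 = \sum_b \sum_a u 0 a * A a b * w 0 b.
Proof.
rewrite mxE; apply: eq_bigr => b _.
by rewrite !mxE mulr_suml; apply: eq_bigr => a _.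
Qed.

Lemma cvg_form (R : realType) (T : Type) (F : set_system T) {FF : Filter F} n
    (f h : T -> 'rV[R]_n) (g : T -> 'M[R]_n) (u w : 'rV[R]_n) (A : 'M[R]_n) :
  f @ F --> u -> g @ F --> A -> h @ F --> w ->
  (f x *m g x *m (h x)^T) 0 0 @[x --> F] --> (u *m A *m w^T) 0 0.
Proof.
move=> fu gA hw; rewrite form_sumE.
under eq_cvg do rewrite form_sumE.
apply: cvg_big => // [|b _]; first exact: add_continuous.
apply: cvg_big => // [|a _]; first exact: add_continuous.
apply: cvgM; last exact: cvg_comp hw (@coord_continuous _ _ _ _ _ w).
apply: cvgM; first exact: cvg_comp fu (@coord_continuous _ _ _ _ _ u).
exact: cvg_comp gA (@coord_continuous _ _ _ _ _ A).
Qed.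

Lemma form_le (R : realType) n (u : 'rV[R]_n) (A : 'M[R]_n) c B :
  (forall k, `|u 0 k| <= c) -> `|A| <= B ->
  (u *m A *m u^T) 0 0 <= n%:R ^+ 2 * B * c ^+ 2.
Proof.
move=> uc AB; rewrite form_sumE.
apply: (@le_trans _ _ (\sum_(b < n) \sum_(a < n) B * c ^+ 2)); last first.
  rewrite !sumr_const card_ord -(mulr_natl (_ *+ _)) -(mulr_natl (_ * _)).
  by rewrite le_eqVlt; apply/orP; left; apply/eqP; ring.
apply: ler_sum => b _; apply: ler_sum => a _.
rewrite (le_trans (ler_norm _))// !normrM mulrAC mulrC expr2.
have AabB : `|A a b| <= B := le_trans (ler_entry_norm _ _ _) AB.
by rewrite ler_pM// ?mulr_ge0// ler_pM.
Qed.

(** * Real functions of one variable *)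

(** The symmetric interval makes room for both signs of the parameter of a
    variation. *)
Lemma increment_le (R : realType) (f : R -> R) C r s :
  (forall t, `|t| < r -> derivable f t 1) ->
  (forall t, `|t| < r -> `|'D_1 f t| <= C) ->
  `|s| < r -> `|f s - f 0| <= C * `|s|.
Proof.
move=> df dfC sr.
have mvt a b : `|a| < r -> `|b| < r -> a <= b ->
    `|f b - f a| <= C * `|b - a|.
  move=> ar br ab.
  have abr t : t \in `[a, b] -> `|t| < r.
    move: ar br; rewrite in_itv/= !ltr_norml => /andP[ra _] /andP[_ br].
    by move=> /andP[at_ tb]; rewrite (lt_le_trans ra)//= (le_lt_trans tb).
  have [||c cab ->] := @MVT_segment _ f (fun t => 'D_1 f t) a b ab.
  - move=> t tab; apply/derivableP/df/abr.
    by apply: subset_itvW tab.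
  - apply: derivable_within_continuous => t tab; exact/df/abr.
  - by rewrite normrM ler_wpM2r// dfC// abr.
have r0 : `|0 : R| < r by rewrite normr0 (le_lt_trans _ sr).
have [s0|s0] := leP 0 s.
  by rewrite -{2}(subr0 s) mvt.
by rewrite distrC -(normrN s) -(sub0r s) mvt// ltW.
Qed.

Lemma derive0_of_quadratic (R : realType) (f : R -> R) C :
  (\forall s \near (0 : R), `|f s - f 0| <= C * s ^+ 2) ->
  is_derive (0 : R) (1 : R) f 0.
Proof.
move=> fC.
have : (fun h : R => h^-1 *: (f (h *: 1 + 0) - f 0)) @ 0^' --> (0 : R).
  apply/(@cvgr0Pnorm_le R R) => e e0.
  (* [C] may be negative or zero, whereas [e] is going to be divided. *)
  pose C0 := `|C| + 1; have C0_gt0 : 0 < C0 by rewrite ltr_wpDl.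
  have CC0 : C <= C0 by rewrite (le_trans (ler_norm _))// lerDl.
  near=> h.
  have h0 : h != 0 by near: h; exact: nbhs_dnbhs_neq.
  rewrite addr0 [_ *: 1]mulr1 normrZ normfV.
  have hC : `|f h - f 0| <= C * h ^+ 2 by near: h; apply: nbhs_dnbhs.
  have he : `|h| <= e / C0.
    by near: h; apply: dnbhs0_le; rewrite divr_gt0.
  rewrite ler_pdivrMl ?normr_gt0// (le_trans hC)//.
  rewrite -real_normK ?num_real// expr2 mulrA mulrC ler_wpM2l//.
  apply: (@le_trans _ _ (C0 * `|h|)); first by rewrite ler_wpM2r.
  by rewrite mulrC -ler_pdivlMr.
move=> fl; apply: DeriveDef; last by apply/cvg_lim => //; exact: fl.
by apply/cvg_ex; exists 0; exact: fl.
Unshelve. all: by end_near. Qed.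

(** * Integrals *)

(** Monotonicity without measurability: the integral of a nonnegative function
    is the supremum of the integrals of the simple functions below it.  The
    inner integrals of an iterated integral can thus be bounded without knowing
    that they depend measurably on the outer variable. *)
Lemma ge0_le_integral_setT d (T : measurableType d) (R : realType)
    (mu : {measure set T -> \bar R}) (f h : T -> \bar R) :
  (forall x, 0 <= f x)%E -> (forall x, f x <= h x)%E ->
  (\int[mu]_(x in [set: T]) f x <= \int[mu]_(x in [set: T]) h x)%E.
Proof.
move=> f0 fh; have h0 x := le_trans (f0 x) (fh x).
rewrite !ge0_integralTE//; apply: le_ereal_sup => _ [k kf <-].
by exists k => // x; exact: le_trans (kf x) (fh x).
Qed.

Lemma integral_rV_ge0 (R : realType) n (f : 'rV[R]_n -> \bar R) :
  (forall v, 0 <= f v)%E -> (0 <= integral_rV f)%E.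
Proof.
elim: n f => [|n IH] f f0 /=; first exact: f0.
by apply: integral_ge0 => t _; apply: IH.
Qed.

(** Each one-dimensional integral contributes a factor [2 * r], the length of
    the interval outside which the integrand vanishes. *)
Lemma integral_rV_box (R : realType) n (f : 'rV[R]_n -> \bar R) (C r : R) :
  0 <= C -> 0 <= r -> (forall v, 0 <= f v)%E -> (forall v, f v <= C%:E)%E ->
  (forall (v : 'rV[R]_n) (k : 'I_n), r < `|v 0 k| -> f v = 0%E) ->
  (integral_rV f <= (C * (2 * r) ^+ n)%:E)%E.
Proof.
move=> + r0; elim: n f C => [|n IH] f C C0 f0 fC fr /=.
  by rewrite expr0 mulr1.
(* Row blocks need the index type written as a sum. *)
have fr1 : forall (v : 'rV[R]_(1 + n)) (k : 'I_(1 + n)),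
  r < `|v 0 k| -> f v = 0%E := fr.
set I := `[- r, r]%classic : set R.
pose K := C * (2 * r) ^+ n.
have K0 : 0 <= K by rewrite mulr_ge0// exprn_ge0// mulr_ge0.
apply: (@le_trans _ _ (\int[lebesgue_measure]_(t in [set: R])
    (K * \1_I t)%:E)%E).
  apply: ge0_le_integral_setT => [t|t]; first exact: integral_rV_ge0.
  rewrite indicE; have [tI|tI] := boolP (t \in I).
    rewrite mulr1; apply: IH => // v k vr.
    by have := fr1 (row_mx t%:M v) (rshift 1 k); rewrite row_mxEr => ->.
  (* Outside the interval, the bound of the induction hypothesis is used with
     the constant 0. *)
  have f_eq0 v : f (row_mx t%:M v) = 0%E.
    have := fr1 (row_mx t%:M v) (lshift n 0); rewrite row_mxEl mxE eqxx mulr1n.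
    apply; move: tI; rewrite notin_setE /I/= in_itv/= -ler_norml.
    by rewrite ltNge => /negP.
  by rewrite mulr0 -(mul0r ((2 * r) ^+ n)); apply: IH => // v; rewrite f_eq0.
under eq_integral do rewrite EFinM.
rewrite ge0_integralZl//; last first.
  by apply/measurable_EFinP; apply: measurable_indic; exact: measurable_itv.
rewrite integral_indic//=; last exact: measurable_itv.
rewrite setIT [X in (_ * X)%E]lebesgue_measure_itv/=.
case: ifPn => _; rewrite -?EFinD -?EFinM lee_fin.
  by rewrite exprSr /K mulrA opprK; lra.
by rewrite mulr0 mulr_ge0// exprn_ge0// mulr_ge0.
Qed.

(** The bound on the integrand integrates to a bound on the integral because the
    measure of the domain is finite. *)
Lemma is_derive0_Rintegral d (T : measurableType d) (R : realType)
    (mu : {measure set T -> \bar R}) (D : set T) (f : R -> T -> R) C :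
  measurable D -> (mu D < +oo)%E ->
  (\forall s \near (0 : R), mu.-integrable D (EFin \o f s)) ->
  (\forall s \near (0 : R), forall x, D x -> `|f s x - f 0 x| <= C * s ^+ 2) ->
  is_derive (0 : R) (1 : R) (fun s => \int[mu]_(x in D) f s x) 0.
Proof.
move=> mD Doo int_f fC.
have int_f0 : mu.-integrable D (EFin \o f 0) := nbhs_singleton int_f.
apply: (@derive0_of_quadratic _ _ (C * fine (mu D))).
near=> s.
have int_fs : mu.-integrable D (EFin \o f s) by near: s.
have int_d : mu.-integrable D (EFin \o (fun x => f s x - f 0 x)).
  exact: (integrableB mD int_fs int_f0).
rewrite -RintegralB// (le_trans (le_normr_Rintegral _ _))//.
apply: (@le_trans _ _ (\int[mu]_(x in D) (C * s ^+ 2))); last first.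
  by rewrite Rintegral_cst// mulrAC.
apply: le_Rintegral => //.
- exact: (integrable_abse int_d).
- apply: measurable_bounded_integrable => //.
  exists `|C * s ^+ 2|; split; first exact: num_real.
  by move=> B /ltW CB x _.
- by near: s.
Unshelve. all: by end_near. Qed.

(** * Charts *)

Section Charts.
Variables (R : realType) (n : nat) (M : oriented_manifold R n).
Implicit Types (p q : M) (i j : chart_index M).

Lemma nbhs_chart_cod i p : dom i p -> nbhs (chart i p) (chart_cod i).
Proof.
move=> ip; apply: open_nbhs_nbhs; split; first exact: open_chart_dom.
by exists p.
Qed.

Lemma near_inv_chart i p (Q : set M) : dom i p -> nbhs p Q ->
  \forall y \near chart i p, chart_cod i y /\ Q (inv_chart i y).
Proof.
move=> ip pQ; near=> y; split; near: y; first exact: nbhs_chart_cod.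
apply: (@inv_chart_continuous _ _ M i (chart i p)); first by exists p.
by rewrite chartK.
Unshelve. all: by end_near. Qed.

Lemma near_chart i p (Q : set 'rV[R]_n) : dom i p -> nbhs (chart i p) Q ->
  \forall q \near p, dom i q /\ Q (chart i q).
Proof.
move=> ip pQ; near=> q; split; near: q.
  by apply: open_nbhs_nbhs; split => //; exact: open_dom.
exact: (chart_continuous ip pQ).
Unshelve. all: by end_near. Qed.

Lemma transition_differentiable i j p : dom i p -> dom j p ->
  differentiable (chart j \o inv_chart i) (chart i p).
Proof.
by move=> ip jp; apply: (@transition_smooth _ _ M i j [::]); exists p.
Qed.

(** The chain rule, applied to a transition map followed by its inverse; only
    near the point is the composite the identity. *)
Lemma tjacK i j p : dom i p -> dom j p -> tjac i j p *m tjac j i p = 1%:M.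
Proof.
move=> ip jp; apply/row_matrixP => k; rewrite !rowE mulmxA mulmx1.
set u := delta_mx 0 k; rewrite /tjac /jacobian !mul_rV_lin1/=.
have fE : (chart j \o inv_chart i) (chart i p) = chart j p by rewrite /= chartK.
have df := transition_differentiable ip jp.
have dh := transition_differentiable jp ip.
have := diff_comp df; rewrite fE => /(_ _ _ dh) dcomp.
have did : 'd ((chart i \o inv_chart j) \o (chart j \o inv_chart i)) (chart i p)
    = idfun :> ('rV[R]_n -> 'rV[R]_n).
  apply: near_linear_diff; first by move=> y; exact: cvg_id.
  have jdom : nbhs p (dom j).
    by apply: open_nbhs_nbhs; split => //; exact: open_dom.
  near=> y.
  have [[r ir <-] jr] : chart_cod i y /\ dom j (inv_chart i y).
    by near: y; exact: near_inv_chart.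
  by rewrite /= in jr *; rewrite !chartK// -[X in dom j X](chartK ir).
transitivity (('d (chart i \o inv_chart j) (chart j p)
    \o 'd (chart j \o inv_chart i) (chart i p)) u); first by [].
by rewrite -dcomp did.
Unshelve. all: by end_near. Qed.

Lemma field_repE (X : vector_field M) i p : dom i p ->
  field_rep X i (chart i p) = (X p : 'rV_n) *m tjac (chart_at p) i p.
Proof. by move=> ip; rewrite /field_rep /= chartK. Qed.

(** The components [X p] refer to a chart that jumps with [p]; continuity makes
    sense only after a change to a fixed chart. *)
Lemma smooth_field_continuous (X : vector_field M) i p :
  smooth_field X -> dom i p -> {for p, continuous (field_rep X i \o chart i)}.
Proof.
move=> Xs ip; apply: continuous_comp; first exact: chart_continuous.
by apply: differentiable_continuous; apply: (Xs i [::]); exists p.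
Qed.

(** A section followed by the projection is the identity of M, so its
    differential is a section of the differential of the projection. *)
Lemma proj_dsection (X : vector_field M) p (Y : tangent p) :
  smooth_field X -> dproj (dsection X Y) = Y.
Proof.
move=> Xs; rewrite dprojE /dsection; set i := chart_at p.
have ip : dom i p := dom_chart_at p.
have dX : differentiable (field_rep X i) (chart i p).
  by apply: (Xs i [::]); exists p.
have dchart := transition_differentiable ip ip.
have -> : tchart i \o section X \o inv_chart i =
    (fun y => ((chart i \o inv_chart i) y, field_rep X i y)) by [].
rewrite diff_pair//= (@near_linear_diff _ _ _ _ idfun)//.
  by move=> y; exact: cvg_id.
near=> y; have [r ir <-] : chart_cod i y by near: y; exact: nbhs_chart_cod.
by rewrite /= chartK.
Unshelve. all: by end_near. Qed.

End Charts.

(** * The metric *)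

Lemma form_change_basis (R : realType) n (v w : 'rV[R]_n) (T J G : 'M[R]_n) :
  T *m J = 1%:M ->
  v *m T *m (J *m G *m J^T) *m (w *m T)^T = v *m G *m w^T.
Proof.
move=> TJ; rewrite trmx_mul !mulmxA -(mulmxA v) TJ mulmx1.
by rewrite -(mulmxA _ J^T) -trmx_mul TJ trmx1 mulmx1.
Qed.

Section Metric.
Variables (R : realType) (n : nat) (M : oriented_manifold R n).
Variable g : riemannian_metric M.
Implicit Types (p q : M) (i : chart_index M).

(** The inner product is independent of the chart: this trades the preferred
    chart at [p] for any chart around [p]. *)
Lemma innerE i p (v w : tangent p) : dom i p ->
  let T := tjac (chart_at p) i p in
  inner g v w = (((v : 'rV_n) *m T) *m metric_rep g i (chart i p)
    *m ((w : 'rV_n) *m T)^T) 0 0.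
Proof.
move=> ip T; rewrite /inner /metric_rep chartK//.
have TK : T *m tjac i (chart_at p) p = 1%:M.
  by apply: tjacK => //; exact: dom_chart_at.
by rewrite form_change_basis.
Qed.

Lemma metric_rep_continuous i p : dom i p ->
  {for chart i p, continuous (metric_rep g i)}.
Proof.
move=> ip; apply: differentiable_continuous.
by apply: (@gram_smooth _ _ _ g i [::]); exists p.
Qed.

Lemma inner_continuous (X Y : vector_field M) :
  smooth_field X -> smooth_field Y ->
  continuous (fun p : M => inner g (X p) (Y p)).
Proof.
move=> Xs Ys p; set i := chart_at p; have ip : dom i p := dom_chart_at p.
have E q : dom i q -> inner g (X q) (Y q) =
    (field_rep X i (chart i q) *m metric_rep g i (chart i q)
      *m (field_rep Y i (chart i q))^T) 0 0.
  by move=> iq; rewrite (innerE _ _ iq) !field_repE.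
rewrite /continuous_at E//.
apply: cvg_trans (cvg_form (smooth_field_continuous Xs ip) _
  (smooth_field_continuous Ys ip)).
  apply: near_eq_cvg; near=> q; apply/esym/E; near: q.
  by apply: open_nbhs_nbhs; split => //; exact: open_dom.
exact: continuous_comp (chart_continuous ip) (metric_rep_continuous ip).
Unshelve. all: by end_near. Qed.

(** For unit vectors the inner product falls short of 1 only to second order in
    their difference; this is the source of the vanishing derivative. *)
Lemma inner_polar p (u v : tangent p) : inner g u u = 1 -> inner g v v = 1 ->
  inner g u v = 1 - 2^-1 * @inner _ _ _ g p ((u : 'rV_n) - v) ((u : 'rV_n) - v).
Proof.
move=> uu vv; have vu : inner g v u = inner g u v.
  rewrite /inner -[in LHS](trmxK (_ *m _)) mxE !trmx_mul trmxK gram_sym.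
  by rewrite mulmxA.
have trB : ((u : 'rV_n) - v)^T = (u : 'rV_n)^T - (v : 'rV_n)^T.
  by apply/matrixP => a b; rewrite !mxE.
move: uu vv vu; rewrite /inner trB !mulmxBl !mulmxBr => uu vv vu.
by rewrite !mxE in uu vv vu *; rewrite uu vv vu; field.
Qed.

End Metric.

(** * The Riemannian volume *)

Section Volume.
Variables (R : realType) (n : nat) (M : oriented_manifold R n).
Implicit Types (p q : M) (D : set (borel M)).

Lemma open_borel (A : set M) : open A -> measurable (A : set (borel M)).
Proof. by move=> oA; apply: sub_sigma_algebra; exact: oA. Qed.

Lemma compact_borel (A : set M) : compact A -> measurable (A : set (borel M)).
Proof.
move=> /(compact_closed (@carrier_hausdorff _ _ M)) cA.
rewrite -(setCK A); apply: measurableC; apply: open_borel.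
exact: closed_openC.
Qed.

Lemma continuous_borel (f : M -> R) D : measurable D ->
  continuous f -> measurable_fun D (f : borel M -> R).
Proof.
move=> mD /continuousP cf; apply: (measurability _ (RGenOpens.measurableE R)).
move=> _ [_ [a [b ->] <-]]; apply: measurableI => //; apply: open_borel.
by apply: cf; exact: interval_open.
Qed.

Variable mu : {measure set (borel M) -> \bar R}.

(** In a chart the volume has a continuous density, bounded near [p], and a
    small neighbourhood of [p] has a bounded image. *)
Lemma volume_locally_finite (g : riemannian_metric M) p :
  is_riemannian_volume g mu ->
  exists U : set (borel M), [/\ open (U : set M), U p & (mu U < +oo)%E].
Proof.
move=> volmu; set i := chart_at p; have ip : dom i p := dom_chart_at p.
pose y := chart i p; pose G := metric_rep g i.
pose r := `|y| + 1; pose C := `|\det (G y)| + 1.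
have C0 : 0 <= C by rewrite addr_ge0.
pose U : set M := interior (fun q => dom i q /\
  (`|chart i q| <= r /\ `|\det (G (chart i q))| <= C)).
have Up : U p.
  apply: (near_chart (Q := fun z => `|z| <= r /\ `|\det (G z)| <= C)) => //.
  apply: filterI.
    apply: (@near_norm_le R 'rV[R]_n 'rV[R]_n id y); exact: cvg_id.
  apply: (@near_norm_le R 'rV[R]_n R (fun z => \det (G z)) y).
  have := cvg_det (metric_rep_continuous (g := g) ip).
  by apply; exact: nbhs_filter.
have oU : open U by exact: open_interior.
exists U; split => //; rewrite (volmu i)//; last 2 first.
- exact: open_borel.
- by move=> q /interior_subset[].
apply: (@le_lt_trans _ _ (Num.sqrt C * (2 * r) ^+ n)%:E); last exact: ltry.
apply: integral_rV_box => //.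
- by rewrite addr_ge0.
- move=> z; rewrite lee_fin indicE; have [|_] := boolP (z \in _).
    rewrite inE => -[q /interior_subset[_ [_ qC]] <-].
    by rewrite mul1r ler_wsqrtr// (le_trans (ler_norm _)).
  by rewrite mul0r.
- move=> z k rz; rewrite indicE memNset ?mul0r// => -[q].
  move=> /interior_subset[_ [qr _]] qz; move: rz; rewrite -qz ltNge.
  by rewrite (le_trans (ler_entry_norm _ _ _) qr).
Unshelve. all: by end_near. Qed.

Lemma compact_volume_lty (D : set (borel M)) :
  (forall p, exists U : set (borel M),
    [/\ open (U : set M), U p & (mu U < +oo)%E]) ->
  compact (D : set M) -> (mu D < +oo)%E.
Proof.
move=> /choice[U UP] cD.
have [E _ DE] : finite_subset_cover (D : set M) (U : M -> set M) D.
  move: (cD); rewrite compact_cover; apply.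
    by move=> p _; have [] := UP p.
  by move=> p Dp; exists p => //; have [] := UP p.
pose V : set (borel M) := \bigcup_(p in [set` E]) U p.
have [mV Voo] : measurable V /\ (mu V < +oo)%E.
  rewrite /V bigcup_fset.
  apply: (big_ind
    (fun A : set (borel M) => measurable A /\ (mu A < +oo)%E)).
  - by rewrite measure0; split.
  - move=> A B [mA Aoo] [mB Boo]; split; first exact: measurableU.
    by rewrite (le_lt_trans (measureU2 _ _ _))// lte_add_pinfty.
  - by move=> p _; have [oU _ Uoo] := UP p; split=> //; exact: open_borel.
apply: le_lt_trans Voo; apply: le_measure; rewrite ?inE//; exact: compact_borel.
Qed.

End Volume.

(** * Variations *)

Lemma is_derive_line (R : realType) (V W : normedModType R)
    (h : R * V -> W) t (y : V) : differentiable h (t, y) ->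
  is_derive t (1 : R) (fun t => h (t, y)) ('D_(1, 0) h (t, y)).
Proof.
move=> dh.
have E : (fun x : R => x^-1 *:
      (((fun t => h (t, y)) \o shift t) (x *: 1) - h (t, y))) =
    (fun x : R => x^-1 *: ((h \o shift (t, y)) (x *: (1, 0)) - h (t, y))).
  apply/funext => x /=; congr (_ *: (h _ - _)).
  by apply: injective_projections; rewrite /= ?scaler0 ?add0r.
apply: DeriveDef; last by rewrite /derive E.
by have := @diff_derivable _ _ _ h _ (1, 0) dh; rewrite /derivable E.
Qed.

Section Variation.
Variables (R : realType) (n : nat) (M : oriented_manifold R n).
Variables (g : riemannian_metric M) (X : vector_field M) (D : set M).
Variables (eps : R) (Xs : R -> vector_field M).
Hypothesis var : Defs.variation g X D eps Xs.
Implicit Types p q : M.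

Definition sq_dist (s : R) (p : M) : R :=
  @inner R n M g p ((Xs s p : 'rV_n) - X p) ((Xs s p : 'rV_n) - X p).

Lemma sq_dist_ge0 s p : 0 <= sq_dist s p.
Proof.
rewrite /sq_dist; set v := _ - _.
have [->|v0] := eqVneq v 0; first by rewrite /inner !mul0mx mxE.
exact/ltW/gram_pos.
Qed.

(** The components of X^s in a chart are smooth jointly in [s] and the point.
    Their [s]-derivative [dh] is thus bounded near [(0, p)], and the mean value
    theorem gives |X^s - X| = O(|s|) there. *)
Lemma near_sq_dist_le p :
  exists C, \forall q \near p & s \near (0 : R), sq_dist s q <= C * s ^+ 2.
Proof.
case: var => eps0 smX _ X0 _.
set i := chart_at p; have ip : dom i p := dom_chart_at p.
pose h (z : R * 'rV[R]_n) := field_rep (Xs z.1) i z.2.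
pose O := [set z : R * 'rV[R]_n | `|z.1| < eps /\ chart_cod i z.2].
pose y := chart i p; pose G := metric_rep g i.
pose dh := 'D_(1, 0) h; pose c := `|dh (0, y)| + 1; pose B := `|G y| + 1.
have dhc : \forall z \near (0, y), `|dh z| <= c.
  apply: near_norm_le; apply: differentiable_continuous.
  apply: (smX i [:: (1, 0)] (0, y)); split; first by rewrite /= normr0.
  by exists p.
have nbhs0_eps : \forall t \near (0 : R), `|t| < eps by exact: nbhs0_lt.
have nO : nbhs (0 : R, y) O.
  exists ([set t | `|t| < eps], chart_cod i) => //; split => /=.
    exact: nbhs0_eps.
  exact: nbhs_chart_cod.
have [[A1 A2] [/= nA1 nA2] sub] := filterI dhc nO.
have [r /= r0 rA1] := (nbhs_ballP _ _).1 nA1.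
have GB : \forall z \near y, `|G z| <= B.
  by apply: near_norm_le; exact: metric_rep_continuous.
exists (n%:R ^+ 2 * B * c ^+ 2).
exists ((fun q => dom i q /\ (A2 (chart i q) /\ `|G (chart i q)| <= B)),
  [set s | `|s| < r]); first split => /=.
- apply: (near_chart (Q := fun z => A2 z /\ `|G z| <= B)) => //.
  exact: filterI.
- by have : \forall t \near (0 : R), `|t| < r by exact: nbhs0_lt.
case=> q s /= [[iq [A2q GBq]] sr].
have inO t : `|t| < r -> `|dh (t, chart i q)| <= c /\ O (t, chart i q).
  move=> tr; apply: (sub (t, chart i q)); split=> //=; apply: rA1.
  by rewrite /ball/= sub0r normrN.
rewrite /sq_dist (innerE g _ _ iq) -/(G _) mulmxBl -!field_repE//.
apply: le_trans (form_le (c := c * `|s|) _ GBq) _; last first.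
  by rewrite exprMn real_normK ?num_real// mulrA.
move=> k; rewrite [X in `|X|]mxE [X in _ + X]mxE.
have -> : field_rep X i (chart i q) = field_rep (Xs 0) i (chart i q).
  by rewrite !field_repE// X0.
apply: (@increment_le R (fun t => h (t, chart i q) 0 k) c r) => // t tr.
all: have [dht Ot] := inO t tr.
all: have [dl dE] := is_derive_line (smX i [::] _ Ot).
  exact: (derivable_mxP _ _ _).1 dl 0 k.
have := derive_mx dl; rewrite dE => /(congr1 (fun A : 'rV_n => A 0 k)).
by rewrite mxE => <-; exact: le_trans (ler_entry_norm _ _ _) dht.
Qed.

(** Letting the constant tend to +oo together with [s] tending to 0 allows a
    single covering argument to choose both uniformly over [D]. *)
Lemma compact_sq_dist_le : compact D ->
  exists C, \forall s \near (0 : R),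
    forall p, D p -> sq_dist s p <= C * s ^+ 2.
Proof.
move=> /compact_near_coveringP cD.
have := cD _ (filter_prod +oo%R (nbhs (0 : R)))
  (fun (Cs : R * R) p => sq_dist Cs.2 p <= Cs.1 * Cs.2 ^+ 2) _.
case.
  move=> p _; have [C CP] := near_sq_dist_le p.
  have [[A1 A2] [/= nA1 nA2] sub] := CP.
  exists (A1, [set Cs | C <= Cs.1 /\ A2 Cs.2]); first split => //=.
    exists ([set x | C <= x], A2) => //=; split => //=.
    by apply: nbhs_pinfty_ge; exact: num_real.
  case=> q [C' s] /= [A1q [CC' A2s]].
  by rewrite (le_trans (sub (q, s) _))//= ler_wpM2r// sqr_ge0.
case=> A1 A2 /= [nA1 nA2] sub.
have [C A1C] : exists C, A1 C by exact: filter_ex nA1.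
by exists C; apply: filterS nA2 => s A2s p Dp; exact: (sub (C, s)).
Qed.

End Variation.

(** * The charge term *)

Section Charge.
Variables (R : realType) (n : nat) (M : oriented_manifold R n).
Variable g : riemannian_metric M.
Variable dvg : {measure set (borel M) -> \bar R}.
Hypothesis hdvg : is_riemannian_volume g dvg.
Variables (X : vector_field M) (D : set M) (eps : R).
Variable Xs : R -> vector_field M.
Hypothesis unitX : unit_vector_field g X.
Hypothesis cD : compact D.
Hypothesis var : Defs.variation g X D eps Xs.

(** Between [s] = 0 and a small [s] the integrand drops by |X^s - X|^2 / 2, so
    the integral drops by at most a multiple of s^2 times the volume of [D]. *)
Lemma is_derive_charge_term : is_derive (0 : R) (1 : R)
  (fun s => \int[dvg]_(p in (D : set (borel M)))
     contact_form g (dsection (Xs s) (X p))) 0.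
Proof.
have [eps0 _ unitXs X0 _] := var; have [smX uX] := unitX.
have [C CP] := compact_sq_dist_le var cD.
have mD : measurable (D : set (borel M)) by exact: compact_borel.
have Doo : (dvg (D : set (borel M)) < +oo)%E.
  by apply: compact_volume_lty (cD) => p; exact: volume_locally_finite hdvg.
pose f s p := contact_form g (dsection (Xs s) (X p)).
have fE s p : `|s| < eps -> f s p = 1 - 2^-1 * sq_dist g X Xs s p.
  move=> /unitXs[smXs uXs]; rewrite /f /contact_form proj_dsection//.
  exact: inner_polar (uXs p) (uX p).
have int_f s : `|s| < eps ->
    (forall p, D p -> sq_dist g X Xs s p <= C * s ^+ 2) ->
    dvg.-integrable (D : set (borel M)) (EFin \o f s).
  move=> seps Cs; have [smXs _] := unitXs s seps.
  apply: measurable_bounded_integrable => //.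
    apply: continuous_borel => //.
    rewrite (_ : f s = fun p => inner g (Xs s p) (X p)).
      exact: inner_continuous.
    by apply/funext => p; rewrite /f /contact_form proj_dsection.
  exists (1 + C * s ^+ 2); split; first exact: num_real.
  move=> B CB p Dp; rewrite /= fE//; apply: le_trans (ltW CB).
  have := sq_dist_ge0 g X Xs s p; have := Cs p Dp.
  by rewrite ler_norml => ? ?; apply/andP; split; lra.
have near_eps : \forall s \near (0 : R), `|s| < eps by exact: nbhs0_lt.
apply: (@is_derive0_Rintegral _ (borel M) R dvg D f (2^-1 * C)) => //.
  by apply: filterS2 near_eps CP => s; exact: int_f.
apply: filterS2 near_eps CP => s seps Cs p Dp.
rewrite !fE ?normr0//.
have -> : sq_dist g X Xs 0 p = 0.
  by rewrite /sq_dist X0 subrr /inner !mul0mx mxE.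
have := sq_dist_ge0 g X Xs s p; have := Cs p Dp.
by rewrite ler_norml => ? ?; apply/andP; split; lra.
Qed.

End Charge.

Theorem theorem4p3 (R : realType) (n : nat) (M : oriented_manifold R n)
    (g : riemannian_metric M) (dvg : {measure set (borel M) -> \bar R})
    (hdvg : is_riemannian_volume g dvg) (q : R)
    (X : vector_field M) (hX : unit_vector_field g X) :
  critical_point g (landau_hall g dvg q X) X <->
  critical_point g (dirichlet_energy g dvg) X.
Proof.
split=> crit D eps Xs regD var; have dF := crit D eps Xs regD var;
    have dI := is_derive_charge_term hdvg hX regD.1 var.
- have := is_deriveB dF (is_deriveZ q dI).
  rewrite scaler0 subr0; congr is_derive.
  by apply/funext => s; rewrite /= !fctE /landau_hall addrK.
- by have := is_deriveD dF (is_deriveZ q dI); rewrite scaler0 addr0.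
Qed.
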